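(* Suppose that a group $G$ acts geometrically on a CAT(0) space $X$ and $|\partial X|>2$. If $X$ is hyperbolic, then the boundary $\partial X$ is a scrambled set. Moreover, there exists a constant $c>0$ such that $\limsup\{d_{\partial X}(g\alpha,g\beta)\mid g\in G\}>c$ for any $\alpha,\beta\in\partial X$ with $\alpha\neq\beta$.
   Context: A geometric action is an action by isometries which is proper and cocompact. A geodesic space is hyperbolic if there is $\delta>0$ such that every geodesic triangle is $\delta$-slim (each side lies in the $\delta$-neighbourhood of the union of the other two). $\partial X$ is the visual boundary; a basepoint $x_0\in X$ is fixed, $\xi_{x_0,\alpha}$ is the geodesic ray from $x_0$ to $\alpha\in\partial X$, and $d_{\partial X}(\alpha,\beta)=\sum_{i=1}^\infty\min\{d(\xi_{x_0,\alpha}(i),\xi_{x_0,\beta}(i)),2^{-i}\}$. $\partial X$ is a scrambled set if for all $\alpha\neq\beta$ in $\partial X$, $\limsup\{d_{\partial X}(g\alpha,g\beta)\mid g\in G\}>0$ and $\liminf\{d_{\partial X}(g\alpha,g\beta)\mid g\in G\}=0$, where limsup/liminf are taken as $g$ leaves every finite subset of $G$. *)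

(* Defs.v *)
From Stdlib Require Import ClassicalEpsilon.
From mathcomp Require Import all_boot all_order all_algebra monoid.
From mathcomp Require Import all_classical all_reals all_analysis.

Set Implicit Arguments.
Unset Strict Implicit.
Unset Printing Implicit Defensive.

Import Order.TTheory GRing.Theory Num.Theory.
Local Open Scope classical_set_scope.
Local Open Scope ring_scope.

Section Metric.
Variables (R : realType) (X : Type) (d : X -> X -> R).

Definition is_metric : Prop :=
  (forall x y, d x y = 0 <-> x = y) /\ (forall x y, d x y = d y x) /\
  (forall x y z, d x z <= d x y + d y z).

(* c : [0, d p q] -> X is a geodesic segment from p to q (values outside
   [0, d p q] are irrelevant) *)
Definition geodesic_segment (c : R -> X) (p q : X) : Prop :=
  c 0 = p /\ c (d p q) = q /\
  forall s t, 0 <= s <= d p q -> 0 <= t <= d p q -> d (c s) (c t) = `|s - t|.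

Definition geodesic_space : Prop :=
  forall p q, exists c, geodesic_segment c p q.

Definition distE (a b : R * R) : R :=
  Num.sqrt ((a.1 - b.1) ^+ 2 + (a.2 - b.2) ^+ 2).

Definition cmp_point (a b : R * R) (L s : R) : R * R :=
  (a.1 + s / L * (b.1 - a.1), a.2 + s / L * (b.2 - a.2)).

Definition tri_cmp (p q r : X) (c1 c2 c3 : R -> X) (p' q' r' : R * R)
  (x : X) (xb : R * R) : Prop :=
  (exists s, 0 <= s <= d p q /\ x = c1 s /\ xb = cmp_point p' q' (d p q) s) \/
  (exists s, 0 <= s <= d q r /\ x = c2 s /\ xb = cmp_point q' r' (d q r) s) \/
  (exists s, 0 <= s <= d r p /\ x = c3 s /\ xb = cmp_point r' p' (d r p) s).

Definition CAT0 : Prop :=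
  geodesic_space /\
  forall p q r c1 c2 c3,
    geodesic_segment c1 p q -> geodesic_segment c2 q r -> geodesic_segment c3 r p ->
    forall p' q' r' : R * R,
      distE p' q' = d p q -> distE q' r' = d q r -> distE r' p' = d r p ->
      forall x xb y yb, tri_cmp p q r c1 c2 c3 p' q' r' x xb ->
        tri_cmp p q r c1 c2 c3 p' q' r' y yb -> d x y <= distE xb yb.

Definition near_side (x : X) (c : R -> X) (L delta : R) : Prop :=
  exists t, 0 <= t <= L /\ d x (c t) <= delta.

Definition hyperbolic : Prop :=
  exists delta : R, 0 < delta /\
  forall p q r c1 c2 c3,
    geodesic_segment c1 p q -> geodesic_segment c2 q r -> geodesic_segment c3 r p ->
    (forall s, 0 <= s <= d p q ->
       near_side (c1 s) c2 (d q r) delta \/ near_side (c1 s) c3 (d r p) delta) /\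
    (forall s, 0 <= s <= d q r ->
       near_side (c2 s) c1 (d p q) delta \/ near_side (c2 s) c3 (d r p) delta) /\
    (forall s, 0 <= s <= d r p ->
       near_side (c3 s) c1 (d p q) delta \/ near_side (c3 s) c2 (d q r) delta).

Definition metric_open (U : set X) : Prop :=
  forall x, U x -> exists e : R, 0 < e /\ forall y, d x y < e -> U y.

Definition metric_compact (K : set X) : Prop :=
  forall (I : Type) (U : I -> set X), (forall i, metric_open (U i)) ->
    K `<=` \bigcup_i U i ->
    exists J : set I, finite_set J /\ K `<=` \bigcup_(i in J) U i.

Definition geodesic_ray (r : R -> X) : Prop :=
  forall s t, 0 <= s -> 0 <= t -> d (r s) (r t) = `|s - t|.

Definition asymptotic (r r' : R -> X) : Prop :=
  exists C : R, forall t, 0 <= t -> d (r t) (r' t) <= C.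

Definition ray_class (r : R -> X) : set (R -> X) :=
  [set r' | geodesic_ray r' /\ asymptotic r r'].

Definition boundary : set (set (R -> X)) :=
  [set A | exists r, geodesic_ray r /\ A = ray_class r].

(* the geodesic ray from x0 representing alpha (chosen; it is unique in a
   complete CAT(0) space) *)
Definition ray_from (x0 : X) (A : set (R -> X)) : R -> X :=
  epsilon (inhabits (fun _ : R => x0)) (fun r => A r /\ r 0 = x0).

Definition bd_dist (x0 : X) (A B : set (R -> X)) : R :=
  limn (fun n : nat => \sum_(1 <= i < n)
     Num.min (d (ray_from x0 A i%:R) (ray_from x0 B i%:R)) (2%:R ^- i)).

End Metric.

Section Action.
Local Open Scope group_scope.
Variables (R : realType) (G : groupType) (X : Type) (d : X -> X -> R)
  (act : G -> X -> X).

Definition isometric_action : Prop :=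
  (forall x, act 1 x = x) /\ (forall g h x, act (g * h) x = act g (act h x)) /\
  (forall g x y, d (act g x) (act g y) = d x y).

(* proper action (Bridson-Haefliger I.8.2) *)
Definition proper_action : Prop :=
  forall x, exists r : R, (0 < r)%R /\
    finite_set [set g | exists y, (d x y < r)%R /\ (d x (act g y) < r)%R].

Definition cocompact_action : Prop :=
  exists K : set X, metric_compact d K /\ forall x, exists g y, K y /\ x = act g y.

Definition geometric_action : Prop :=
  isometric_action /\ proper_action /\ cocompact_action.

Definition bd_act (g : G) (A : set (R -> X)) : set (R -> X) :=
  [set r' | geodesic_ray d r' /\ exists r, A r /\ asymptotic d (act g \o r) r'].
End Action.

Section LimG.
Local Open Scope ereal_scope.
Variables (R : realType) (G : Type).
Definition limsup_cof (f : G -> R) : \bar R :=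
  ereal_inf [set ereal_sup [set (f g)%:E | g in V] | V in [set V : set G | cofinite_set V]].
Definition liminf_cof (f : G -> R) : \bar R :=
  ereal_sup [set ereal_inf [set (f g)%:E | g in V] | V in [set V : set G | cofinite_set V]].
End LimG.

Definition scrambled (R : realType) (G : groupType) (X : Type) (d : X -> X -> R)
  (act : G -> X -> X) (x0 : X) : Prop :=
  forall A B, boundary d A -> boundary d B -> A <> B ->
    (0 < limsup_cof (fun g : G => bd_dist d x0 (bd_act d act g A) (bd_act d act g B)))%E /\
    liminf_cof (fun g : G => bd_dist d x0 (bd_act d act g A) (bd_act d act g B)) = 0%E.

(* Main.v *)
(* Let c be the ray from x0 to a boundary point C and let A <> C. Once c has diverged from
   the ray to A, slim triangles force the ray from c(s) to A to run back along c:
   its point at time u lies within 4 delta of c(s - u), for s large.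
   Choose g with g^-1 x0 within D of c(s); then d(gA, gB) compares the rays from g^-1 x0 to A
   and B, which by convexity stay within D of those from c(s).
   - Limsup: for C = B the ray to B continues along c while the ray to A runs back, so at
     time u they are at least 2u - 4 delta - 2D apart, uniformly in A and B.
   - Liminf: for C distinct from A and B both rays run back along c, so they are at bounded
     distance at an arbitrarily large time, and CAT(0) convexity makes them close before.
   Rays from arbitrary points exist because a proper cocompact action makes X complete. *)
Require Import Defs.
From Stdlib Require Import ClassicalEpsilon.
From mathcomp Require Import all_boot all_order all_algebra monoid.
From mathcomp Require Import all_classical all_reals all_analysis.
From mathcomp Require Import ring lra.
Import Order.TTheory GRing.Theory Num.Theory.
Import numFieldNormedType.Exports.

Definition complete_dist {R : realType} {X : Type} (d : X -> X -> R) : Prop :=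
  forall x : nat -> X,
    (forall e : R, (0 < e)%R -> exists N, forall n m, (N <= n)%N -> (N <= m)%N ->
       (d (x n) (x m) < e)%R) ->
    exists l, forall e : R, (0 < e)%R -> exists N, forall n, (N <= n)%N -> (d (x n) l < e)%R.

(** Only the first side is constrained; relabelling the triangle cyclically yields the other two. *)
Definition slim_triangles {R : realType} {X : Type} (d : X -> X -> R) (delta : R) : Prop :=
  forall p q r c1 c2 c3,
    geodesic_segment d c1 p q -> geodesic_segment d c2 q r -> geodesic_segment d c3 r p ->
    forall s, (0 <= s <= d p q)%R ->
      near_side d (c1 s) c2 (d q r) delta \/ near_side d (c1 s) c3 (d r p) delta.

(** * Comparison geometry of CAT(0) spaces and their geodesic rays *)

Section CAT0Geometry.
Local Open Scope ring_scope.
Context {R : realType} {X : Type} {d : X -> X -> R}.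
Hypothesis d_metric : is_metric d.

Lemma distxx x : d x x = 0.
Proof. by have [h _] := d_metric; apply/h. Qed.

Lemma distC x y : d x y = d y x.
Proof. by have [_ [h _]] := d_metric. Qed.

Lemma dist_triangle y x z : d x z <= d x y + d y z.
Proof. by have [_ [_ h]] := d_metric. Qed.

Lemma dist0_eq x y : d x y = 0 -> x = y.
Proof. by have [h _] := d_metric; move/h. Qed.

Lemma dist_ge0 x y : 0 <= d x y.
Proof. have := dist_triangle y x x; rewrite distxx (distC y x); lra. Qed.

Lemma geodesic_segment_rev c p q :
  geodesic_segment d c p q -> geodesic_segment d (fun t => c (d p q - t)) q p.
Proof.
move=> [c0 [cL iso]]; split; first by rewrite subr0.
split; first by rewrite (distC q p) subrr.
move=> s t; rewrite (distC q p) => hs ht; rewrite iso; [|lra|lra].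
by rewrite distrC; congr (`|_|); ring.
Qed.

(** The vertices are [(0, 0)], [(L, 0)] and [(x, y)]; the third equation is the law of cosines, kept
    free of division so that it also covers [L = 0]. *)
Lemma comparison_triangle (L M N : R) :
  0 <= L -> 0 <= M -> 0 <= N -> L <= M + N -> M <= L + N -> N <= L + M ->
  exists x y : R, [/\ x ^+ 2 + y ^+ 2 = M ^+ 2,
    (x - L) ^+ 2 + y ^+ 2 = N ^+ 2 & 2 * L * x = L ^+ 2 + M ^+ 2 - N ^+ 2].
Proof.
move=> L0 M0 N0 h1 h2 h3.
have [Leq0|Lneq0] := eqVneq L 0.
  have -> : N = M by lra.
  by exists M, 0; rewrite Leq0; split; ring.
have Lgt0 : 0 < L by rewrite lt_neqAle eq_sym Lneq0.
pose x := (L ^+ 2 + M ^+ 2 - N ^+ 2) / (2 * L).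
have hx : 2 * L * x = L ^+ 2 + M ^+ 2 - N ^+ 2 by rewrite /x; field.
have y2 : 0 <= M ^+ 2 - x ^+ 2.
  have : 0 <= (2 * L) ^+ 2 * (M ^+ 2 - x ^+ 2).
    (* Heron's formula: 16 times the squared area, a product of nonnegative factors. *)
    have -> : (2 * L) ^+ 2 * (M ^+ 2 - x ^+ 2) =
      ((N + M - L) * (N + L - M)) * ((L + M - N) * (L + M + N)).
      transitivity ((2 * L * M) ^+ 2 - (2 * L * x) ^+ 2); first by ring.
      by rewrite hx; ring.
    by apply: mulr_ge0; apply: mulr_ge0; lra.
  by rewrite pmulr_rge0 // exprn_gt0 // mulr_gt0.
exists x, (Num.sqrt (M ^+ 2 - x ^+ 2)); rewrite sqr_sqrtr //; split=> //; first ring.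
transitivity (M ^+ 2 + L ^+ 2 - 2 * L * x); first ring.
by rewrite hx; ring.
Qed.

Hypothesis d_cat0 : CAT0 d.

Lemma geodesic_exists p q : exists c, geodesic_segment d c p q.
Proof. by have [h _] := d_cat0. Qed.

(** The right side is the squared Euclidean distance between the comparison points at proportions
    [l] and [m] on the two sides at [p], rewritten through side lengths. *)
Lemma cat0_law_of_cosines c c' p q r (l m : R) :
  geodesic_segment d c p q -> geodesic_segment d c' p r ->
  0 <= l <= 1 -> 0 <= m <= 1 ->
  d (c (l * d p q)) (c' (m * d p r)) ^+ 2 <=
    l ^+ 2 * d p q ^+ 2 + m ^+ 2 * d p r ^+ 2
    - l * m * (d p q ^+ 2 + d p r ^+ 2 - d q r ^+ 2).
Proof.
move=> gc gc' hl hm.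
have [c2 gc2] := geodesic_exists q r.
have [x [y [n1 n2 n3]]] := comparison_triangle (d p q) (d p r) (d q r)
  (dist_ge0 _ _) (dist_ge0 _ _) (dist_ge0 _ _)
  ltac:(by rewrite (distC q r); apply: dist_triangle)
  ltac:(by apply: dist_triangle)
  ltac:(by rewrite (distC p q); apply: dist_triangle).
have [_ cmp] := d_cat0.
have lpq : 0 <= l * d p q <= d p q.
  by have := dist_ge0 p q; case/andP: hl => ? ? ?; apply/andP; split; nra.
have mpr : 0 <= m * d p r <= d p r.
  by have := dist_ge0 p r; case/andP: hm => ? ? ?; apply/andP; split; nra.
have : d (c (l * d p q)) (c' (m * d p r)) <= distE (l * d p q, 0) (m * x, m * y).
  apply: (cmp p q r c c2 (fun t => c' (d p r - t)) gc gc2 (geodesic_segment_rev _ _ _ gc')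
    (0, 0) (d p q, 0) (x, y)).
  - by rewrite /distE /= subrr !sub0r sqrrN expr0n /= addr0 sqrtr_sqr ger0_norm ?dist_ge0.
  - rewrite /distE /=.
    have -> : (d p q - x) ^+ 2 + (0 - y) ^+ 2 = d q r ^+ 2 by rewrite -n2; ring.
    by rewrite sqrtr_sqr ger0_norm ?dist_ge0.
  - by rewrite /distE /= !subr0 n1 sqrtr_sqr ger0_norm ?dist_ge0 // distC.
  - left; exists (l * d p q); split=> //; split=> //.
    rewrite /cmp_point /= subrr subr0 mulr0 !add0r; congr pair.
    have [->|h] := eqVneq (d p q) 0; first by rewrite !mulr0.
    by field.
  - right; right; exists (d p r - m * d p r); rewrite (distC r p); split; first lra.
    split; first by congr c'; ring.
    rewrite /cmp_point /=.
    have [h|h] := eqVneq (d p r) 0.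
      have [-> ->] : x = 0 /\ y = 0.
        have /eqP := n1; rewrite h expr0n /= paddr_eq0 ?sqr_ge0 // !sqrf_eq0.
        by case/andP=> /eqP-> /eqP->.
      by rewrite !subrr !mulr0 !addr0.
    by congr pair; field.
rewrite /distE /= sub0r sqrrN => h.
have -> : l ^+ 2 * d p q ^+ 2 + m ^+ 2 * d p r ^+ 2
    - l * m * (d p q ^+ 2 + d p r ^+ 2 - d q r ^+ 2) =
    (l * d p q - m * x) ^+ 2 + (m * y) ^+ 2.
  by rewrite -n3 -n1; ring.
rewrite -[leRHS]sqr_sqrtr ?addr_ge0 ?sqr_ge0 //.
by rewrite ler_sqr ?nnegrE ?dist_ge0 ?sqrtr_ge0.
Qed.

(** For [m = l] the bound of the law of cosines collapses to a perfect square. *)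
Lemma thales c c' p q r (l : R) :
  geodesic_segment d c p q -> geodesic_segment d c' p r -> 0 <= l <= 1 ->
  d (c (l * d p q)) (c' (l * d p r)) <= l * d q r.
Proof.
move=> gc gc' hl; rewrite -ler_sqr ?nnegrE ?dist_ge0 //.
  apply: (le_trans (cat0_law_of_cosines _ _ _ _ _ _ _ gc gc' hl hl)).
  by rewrite le_eqVlt; apply/orP; left; apply/eqP; ring.
by rewrite mulr_ge0 ?dist_ge0 //; case/andP: hl.
Qed.

Lemma asymptotic_sym a b : asymptotic d a b -> asymptotic d b a.
Proof. by move=> [C h]; exists C => t /h; rewrite distC. Qed.

Lemma asymptotic_trans b a c : asymptotic d a b -> asymptotic d b c -> asymptotic d a c.
Proof.
move=> [C h] [C' h']; exists (C + C') => t t0.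
by apply: le_trans (dist_triangle (b t) _ _) _; rewrite lerD ?h ?h'.
Qed.

Lemma ray_dist a s t : geodesic_ray d a -> 0 <= s <= t -> d (a s) (a t) = t - s.
Proof. by move=> ra /andP[s0 st]; rewrite ra ?(le_trans s0) // distrC ger0_norm ?subr_ge0. Qed.

Lemma ray_dist0 a t : geodesic_ray d a -> 0 <= t -> d (a 0) (a t) = t.
Proof. by move=> ra t0; rewrite ray_dist ?lexx // subr0. Qed.

Lemma ray_segment a t : geodesic_ray d a -> 0 <= t -> geodesic_segment d a (a 0) (a t).
Proof.
move=> ra t0; split=> //; rewrite ray_dist0 //; split=> // u v hu hv.
by apply: ra; lra.
Qed.

(** [thales] with ratio [t / u]. It serves in two ways: closeness at a late time passes to earlier
    times, and divergence once reached persists. *)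
Lemma rays_common_origin a b (t u : R) :
  geodesic_ray d a -> geodesic_ray d b -> a 0 = b 0 -> 0 <= t <= u -> 0 < u ->
  d (a t) (b t) <= t / u * d (a u) (b u).
Proof.
move=> ra rb ab tu u0.
have ga := ray_segment _ _ ra (ltW u0); have gb := ray_segment _ _ rb (ltW u0).
rewrite -ab in gb.
have hl : 0 <= t / u <= 1.
  by case/andP: tu => t0 tu; rewrite divr_ge0 ?(ltW u0) //= ler_pdivrMr ?mul1r.
have := thales _ _ _ _ _ _ ga gb hl.
rewrite {2}ab (ray_dist0 _ _ ra (ltW u0)) (ray_dist0 _ _ rb (ltW u0)) divfK //.
by rewrite gt_eqF.
Qed.

(** The diagonal [f] from [a 0] to [b u] cuts the quadrilateral into two triangles; [thales] in each
    gives the bound [t / u * C + (1 - t / u) * d (a 0) (b 0)], and [u] can be arbitrarily large. *)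
Lemma asymptotic_dist a b (t : R) :
  geodesic_ray d a -> geodesic_ray d b -> asymptotic d a b -> 0 <= t ->
  d (a t) (b t) <= d (a 0) (b 0).
Proof.
move=> ra rb [C hC] t0; apply/ler_addgt0Pr => e e0.
have C0 : 0 <= C by apply: le_trans (hC 0 (lexx _)); apply: dist_ge0.
have tCe : 0 <= t * C / e by rewrite divr_ge0 ?mulr_ge0 // ltW.
(* Ensures [t <= u] and [t / u * C <= e]. *)
pose u := 1 + t + t * C / e.
have u0 : 0 < u by rewrite /u; lra.
have hl : 0 <= t / u <= 1.
  by rewrite divr_ge0 ?(ltW u0) //= ler_pdivrMr ?mul1r // /u; lra.
have [f gf] := geodesic_exists (a 0) (b u).
have ga := ray_segment _ _ ra (ltW u0).
have gb := geodesic_segment_rev _ _ _ (ray_segment _ _ rb (ltW u0)).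
have h1 := thales _ _ _ _ _ _ ga gf hl.
have hl' : 0 <= 1 - t / u <= 1 by lra.
have h2 := thales _ _ _ _ _ _ (geodesic_segment_rev _ _ _ gf) gb hl'.
rewrite (ray_dist0 _ _ ra (ltW u0)) divfK ?gt_eqF // in h1.
rewrite (distC (b u) (b 0)) (ray_dist0 _ _ rb (ltW u0)) in h2.
rewrite (distC (b u) (a 0)) in h2.
have E1 : d (a 0) (b u) - (1 - t / u) * d (a 0) (b u) = t / u * d (a 0) (b u) by ring.
have E2 : u - (1 - t / u) * u = t by field; rewrite gt_eqF.
rewrite E1 E2 in h2.
apply: (le_trans (dist_triangle (f (t / u * d (a 0) (b u))) _ _)).
rewrite addrC; apply: lerD.
  apply: (le_trans h2); rewrite ler_piMl ?dist_ge0 //; by case/andP: hl'.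
apply: (le_trans h1); apply: (@le_trans _ _ (t / u * C)).
  by apply: ler_wpM2l; [case/andP: hl | apply: hC; apply: ltW].
rewrite mulrAC ler_pdivrMr // /u !mulrDr mulrCA mulfV ?gt_eqF // !mulr1.
by rewrite ler_wpDl // addr_ge0 ?mulr_ge0 // ltW.
Qed.

Hypothesis d_complete : complete_dist d.

(* By the law of cosines the angle at z between the two geodesics tends to 0: the side
   opposite to it is m - n, within 2 d(z, a 0) of the difference of the other two. *)
Lemma geodesics_to_ray_cauchy a (z : X) (f f' : R -> X) (n m t : R) :
  geodesic_ray d a -> geodesic_segment d f z (a n) -> geodesic_segment d f' z (a m) ->
  0 <= t -> 0 < n -> n <= m -> 2 * d z (a 0) <= n -> t + d z (a 0) <= n ->
  d (f t) (f' t) ^+ 2 <= 16 * d z (a 0) * t ^+ 2 / n.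
Proof.
move=> ra gf gf' t0 n0 nm Dn tn.
set D := d z (a 0) in Dn tn *.
have D0 : 0 <= D by apply: dist_ge0.
have nD : d (a 0) (a n) = n by apply: ray_dist0 => //; apply: ltW.
have mD : d (a 0) (a m) = m by apply: ray_dist0 => //; lra.
have M : d (a n) (a m) = m - n by apply: ray_dist => //; lra.
have := dist_triangle (a 0) z (a n); have := dist_triangle z (a 0) (a n).
have := dist_triangle (a 0) z (a m); have := dist_triangle z (a 0) (a m).
have := dist_triangle (a n) z (a m); have := dist_triangle (a m) z (a n).
rewrite (distC (a 0) z) (distC (a m) (a n)) M nD mD -/D.
set L := d z (a n) in gf gf' *; set L' := d z (a m).
move=> h1 h2 h3 h4 h5 h6.
have L0 : 0 < L by lra.
have L'0 : 0 < L' by lra.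
have hl : 0 <= t / L <= 1.
  by rewrite divr_ge0 ?(ltW L0) //= ler_pdivrMr ?mul1r //; lra.
have hl' : 0 <= t / L' <= 1.
  by rewrite divr_ge0 ?(ltW L'0) //= ler_pdivrMr ?mul1r //; lra.
have := cat0_law_of_cosines _ _ _ _ _ _ _ gf gf' hl hl'.
rewrite -/L -/L' M !divfK ?gt_eqF // => /le_trans; apply.
have -> : (t / L) ^+ 2 * L ^+ 2 + (t / L') ^+ 2 * L' ^+ 2 -
    t / L * (t / L') * (L ^+ 2 + L' ^+ 2 - (m - n) ^+ 2) =
  t ^+ 2 * (((m - n) - (L' - L)) * ((m - n) + (L' - L)) / (L * L')).
  by field; rewrite !gt_eqF.
have -> : 16 * D * t ^+ 2 / n = t ^+ 2 * (16 * D / n) by field; rewrite gt_eqF.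
apply: ler_wpM2l; first exact: sqr_ge0.
rewrite ler_pdivrMr ?mulr_gt0 //.
have LL : n * m / 4 <= L * L'.
  have -> : n * m / 4 = (n / 2) * (m / 2) by field.
  by apply: ler_pM; lra.
apply: (@le_trans _ _ (16 * D / n * (n * m / 4))); last first.
  by apply: ler_wpM2l => //; apply: divr_ge0; lra.
(* By triangle inequalities [(m - n) - (L' - L)] is at most [2 * D] and the other factor at most
   [2 * m]. *)
have -> : 16 * D / n * (n * m / 4) = (2 * D) * (2 * m) by field; rewrite gt_eqF.
by apply: ler_pM; lra.
Qed.

(** At each time the geodesics from [z] to the points [a n] form a Cauchy sequence; their pointwise
    limit is the ray sought. *)
Lemma ray_exists a z : geodesic_ray d a ->
  exists r, [/\ geodesic_ray d r, r 0 = z & asymptotic d a r].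
Proof.
move=> ra; set D := d z (a 0).
have D0 : 0 <= D by apply: dist_ge0.
have [f gf] := choice (fun n : nat => geodesic_exists z (a n%:R)).
have cauchy t e : 0 <= t -> 0 < e -> exists N : nat, [/\ t + D <= N%:R &
    forall n m, (N <= n)%N -> (N <= m)%N -> d (f n t) (f m t) < e].
  move=> t0 e0.
  (* Beyond [q] the Cauchy bound drops below [e ^+ 2]; the other summands meet its side
     conditions. *)
  pose q := 16 * D * t ^+ 2 / e ^+ 2; pose B := q + 1 + 2 * D + t.
  have q0 : 0 <= q.
    by rewrite /q divr_ge0 ?sqr_ge0 // mulr_ge0 ?sqr_ge0 // mulr_ge0.
  have Bge0 : 0 <= B by rewrite /B; lra.
  have := archi_boundP Bge0; set N := Num.Def.archi_bound B => BN.
  exists N; split; first by move: BN; rewrite /B; lra.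
  have aux n m : (N <= n)%N -> (n <= m)%N -> d (f n t) (f m t) < e.
    rewrite -(ler_nat R) -(ler_nat R n m) => Nn nm.
    rewrite -ltr_sqr ?nnegrE ?dist_ge0 ?(ltW e0) //.
    have n0 : 0 < n%:R :> R by move: BN; rewrite /B; lra.
    apply: (@le_lt_trans _ _ (16 * D * t ^+ 2 / n%:R)).
      have n1 : 2 * D <= n%:R by move: BN; rewrite /B; lra.
      have n2 : t + D <= n%:R by move: BN; rewrite /B; lra.
      exact: geodesics_to_ray_cauchy ra (gf n) (gf m) t0 n0 nm n1 n2.
    rewrite ltr_pdivrMr // (mulrC (e ^+ 2)) -ltr_pdivrMr ?exprn_gt0 // -/q.
    by move: BN; rewrite /B; lra.
  move=> n m Nn Nm; case/orP: (leq_total n m) => nm; first exact: aux.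
  by rewrite distC; apply: aux.
have limit t : exists l, 0 <= t -> forall e, 0 < e ->
    exists N : nat, t + D <= N%:R /\ forall n, (N <= n)%N -> d (f n t) l < e.
  (* At negative times [z] is a filler value. *)
  case: (leP 0 t) => t0; last by exists z.
  have [] := d_complete (fun n => f n t).
    by move=> e e0; have [N [_ h]] := cauchy t e t0 e0; exists N.
  move=> l hl; exists l => _ e e0.
  have [N1 h1] := hl e e0; have [N2 [h2 _]] := cauchy t 1 t0 ltr01.
  exists (maxn N1 N2); split.
    by apply: le_trans h2 _; rewrite ler_nat leq_maxr.
  by move=> n; rewrite geq_max => /andP[/h1].
have [r hr] := choice limit.
have approx s t e : 0 <= s -> 0 <= t -> 0 < e -> exists n : nat,
    [/\ s + D <= n%:R, t + D <= n%:R, d (f n s) (r s) < e & d (f n t) (r t) < e].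
  move=> s0 t0 e0.
  have [N1 [h1 k1]] := hr s s0 e e0; have [N2 [h2 k2]] := hr t t0 e e0.
  exists (maxn N1 N2); split.
  - by apply: le_trans h1 _; rewrite ler_nat leq_maxl.
  - by apply: le_trans h2 _; rewrite ler_nat leq_maxr.
  - by apply: k1; rewrite leq_maxl.
  - by apply: k2; rewrite leq_maxr.
have len n : n%:R - D <= d z (a n%:R) <= n%:R + D.
  have := dist_triangle z (a 0) (a n%:R); have := dist_triangle (a 0) z (a n%:R).
  rewrite (distC (a 0) z) (ray_dist0 _ _ ra (ler0n _ _)) -/D; lra.
exists r; split.
- move=> s t s0 t0; apply/eqP; rewrite -subr_eq0 -normr_le0.
  apply/ler_addgt0Pr => e e0.
  have e2 : 0 < e / 2 by lra.
  have [n [h1 h2 k1 k2]] := approx s t _ s0 t0 e2.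
  have hn := len n; have [_ [_ iso]] := gf n.
  rewrite -iso; [|lra|lra].
  have := dist_triangle (f n s) (r s) (r t); have := dist_triangle (f n t) (f n s) (r t).
  have := dist_triangle (r s) (f n s) (f n t); have := dist_triangle (r t) (r s) (f n t).
  rewrite (distC (r s) (f n s)) (distC (r t) (f n t)) ler_norml; lra.
- apply: dist0_eq; apply/eqP; rewrite eq_le dist_ge0 andbT.
  apply/ler_addgt0Pr => e e0; rewrite add0r.
  have [n [_ _ k _]] := approx 0 0 e (lexx _) (lexx _) e0.
  by have [f0 _] := gf n; rewrite f0 in k; rewrite distC ltW.
exists (2 * D + 1) => t t0.
have [n [h _ k _]] := approx t t 1 t0 t0 ltr01.
have hn := len n; have [_ [_ iso]] := gf n.
have [n0|n0] := eqVneq (n%:R : R) 0.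
  have [tz Dz] : t = 0 /\ D = 0 by move: h; rewrite n0; lra.
  have [f0 _] := gf n.
  move: k; rewrite tz f0 => k; have := dist_triangle z (a 0) (r 0).
  rewrite (distC (a 0) z) -/D; lra.
have npos : 0 < n%:R :> R by rewrite lt_neqAle eq_sym n0 ler0n.
have hl : 0 <= t / n%:R <= 1.
  by rewrite divr_ge0 ?(ltW npos) //= ler_pdivrMr ?mul1r //; lra.
have hl' : 0 <= 1 - t / n%:R <= 1 by lra.
(* Seen from the common endpoint [a n], the point of [f n] at the proportional time [t / n * L] is
   within [D] of [a t]. *)
have := thales _ _ _ _ _ _ (geodesic_segment_rev _ _ _ (gf n))
  (geodesic_segment_rev _ _ _ (ray_segment _ _ ra (ler0n _ n))) hl'.
rewrite (distC (a n%:R) z) (distC (a n%:R) (a 0)) (ray_dist0 _ _ ra (ler0n _ _)).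
set L := d z (a n%:R) in hn iso *.
have -> : L - (1 - t / n%:R) * L = t / n%:R * L by ring.
have -> : n%:R - (1 - t / n%:R) * n%:R = t by field; rewrite gt_eqF.
rewrite -/D => hT.
have h0 : (1 - t / n%:R) * D <= D by rewrite ler_piMl //; lra.
have := dist_triangle (f n t) (a t) (r t).
have := dist_triangle (f n (t / n%:R * L)) (a t) (f n t).
(* Replacing the proportional time by [t] costs at most the difference of the lengths [L] and
   [n]. *)
have : d (f n (t / n%:R * L)) (f n t) <= D.
  have L0 : 0 <= L by apply: dist_ge0.
  have tL : 0 <= t <= L by lra.
  have tnL : 0 <= t / n%:R * L <= L.
    by case/andP: hl => hl0 hl1; rewrite mulr_ge0 // ler_piMl.
  rewrite iso //.
  have -> : t / n%:R * L - t = t / n%:R * (L - n%:R) by field; rewrite gt_eqF.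
  rewrite normrM ger0_norm; last by case/andP: hl.
  have hLn : `|L - n%:R| <= D by rewrite ler_norml; lra.
  apply: le_trans hLn; rewrite ler_piMl ?normr_ge0 //; by case/andP: hl.
rewrite (distC (a t) (f n (t / n%:R * L))); lra.
Qed.

(* The point a (s - u) is too far from b to be close to the side [a 0, b T] of the triangle
   (a 0, a s, b T), so it is close to [a s, b T], which for T large fellow travels r. *)
Lemma ray_to_other_end_backtracks delta a b :
  0 < delta ->
  slim_triangles d delta ->
  geodesic_ray d a -> geodesic_ray d b -> a 0 = b 0 -> ~ asymptotic d a b ->
  exists m, forall u s, 0 <= u -> m + u <= s -> forall r, geodesic_ray d r ->
    r 0 = a s -> asymptotic d b r -> d (r u) (a (s - u)) <= 4 * delta.
Proof.
move=> dpos slim ra rb ab nab.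
have [m [m0 hm]] : exists m, 0 < m /\ 2 * delta < d (a m) (b m).
  apply: contrapT => h; apply: nab; exists (2 * delta) => t t0.
  rewrite leNgt; apply/negP => h'; apply: h; exists t; split=> //.
  rewrite lt_neqAle t0 andbT; apply/eqP => tz.
  by move: h'; rewrite -tz ab distxx; lra.
exists m => u s u0 mus r rr r0 br.
set v := s - u; have v0 : m <= v by rewrite /v; lra.
(* By convexity [a v] and [b v] are more than [2 * delta] apart, and [b w] is at distance [|w - v|]
   from [b v], which is at most [d (a v) (b w)] since the origin is shared. *)
have far w : 0 <= w -> delta < d (a v) (b w).
  move=> w0.
  have hmv : 0 <= m <= v by lra.
  have vpos : 0 < v by lra.
  have := rays_common_origin _ _ _ _ ra rb ab hmv vpos.
  have mv : m / v <= 1 by rewrite ler_pdivrMr ?mul1r.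
  have : m / v * d (a v) (b v) <= d (a v) (b v) by rewrite ler_piMl ?dist_ge0.
  have := dist_triangle (b w) (a v) (b v).
  have av : d (a v) (a 0) = v by rewrite distC ray_dist0 // ltW.
  have bw : d (b w) (a 0) = w by rewrite distC ab ray_dist0.
  have := dist_triangle (b w) (a v) (a 0); have := dist_triangle (a v) (b w) (a 0).
  rewrite rb ?(ltW vpos) // av bw (distC (b w) (a v)).
  case: (ger0P (w - v)); lra.
(* So large that the side from [b T] to [r T], of length at most [s], stays more than [2 * delta]
   away from [a v]. *)
pose T := 2 * s + 2 * delta + 1.
have s0 : 0 <= s by lra.
have T0 : 0 <= T by rewrite /T; lra.
have [c gc] := geodesic_exists (a s) (b T).
have [e ge] := geodesic_exists (b T) (r T).
have gb := geodesic_segment_rev _ _ _ (ray_segment _ _ rb T0).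
rewrite -ab in gb.
have hv : 0 <= v <= d (a 0) (a s) by rewrite (ray_dist0 _ _ ra s0) /v; lra.
have bT : d (a 0) (b T) = T by rewrite ab ray_dist0.
have := slim _ _ _ _ _ _ (ray_segment _ _ ra s0) gc gb v hv.
case=> [[w [hw hvw]]|[w [hw hvw]]]; last first.
  move: hw hvw; rewrite (distC (b T)) bT => hw hvw.
  by have /far : 0 <= T - w; lra.
have gr := geodesic_segment_rev _ _ _ (ray_segment _ _ rr T0).
rewrite r0 in gr.
have rT : d (a s) (r T) = T by rewrite -r0 ray_dist0.
have brT : d (b T) (r T) <= s.
  apply: (le_trans (asymptotic_dist _ _ _ rb rr br T0)).
  by rewrite r0 -ab ray_dist0.
have := slim _ _ _ _ _ _ gc ge gr w hw.
case=> [[x [hx hwx]]|[x [hx hwx]]].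
  have [e0 [e1 iso]] := ge.
  have := dist_triangle (c w) (a v) (e x); have := dist_triangle (e x) (a v) (b T).
  have : d (b T) (e x) = x by rewrite -e0 iso ?sub0r ?normrN ?ger0_norm; lra.
  have := dist_triangle (a v) (a 0) (b T).
  rewrite bT (ray_dist0 _ _ ra) ?(distC (e x)); last lra.
  rewrite /T /v; lra.
move: hx hwx; rewrite (distC (r T)) rT => hx hwx.
set y := T - x in hwx; have y0 : 0 <= y by rewrite /y; lra.
(* Here [r y] is within [2 * delta] of [a v]; comparing distances to [a s] gives
   [|y - u| <= 2 * delta], whence the total [4 * delta]. *)
have := dist_triangle (c w) (a v) (r y); have := dist_triangle (r y) (r u) (a v).
have := dist_triangle (a v) (a s) (r y); have := dist_triangle (r y) (a s) (a v).
have -> : d (a s) (a v) = u by rewrite distC ray_dist // /v; lra.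
have -> : d (a s) (r y) = y by rewrite -r0 ray_dist0.
rewrite rr // (distC (r y)).
case: (ger0P (u - y)); lra.
Qed.

End CAT0Geometry.

(** * Bounds for the series defining the boundary metric *)

Section TruncatedSeries.
Local Open Scope ring_scope.
Local Open Scope classical_set_scope.
Context {R : realType}.
Variable e : nat -> R.
Hypothesis e_ge0 : forall i, 0 <= e i.

Let psum (n : nat) : R := \sum_(1 <= i < n) Num.min (e i) (2%:R ^- i).

Let half_pow (n : nat) : (2%:R ^- n : R) = 2%:R ^- n.+1 + 2%:R ^- n.+1.
Proof. by rewrite exprS; field; rewrite expf_neq0 // pnatr_eq0. Qed.

Let half_pow_gt0 (n : nat) : 0 < (2%:R ^- n : R).
Proof. by rewrite invr_gt0 exprn_gt0 // ltr0n. Qed.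

Let psumS (n : nat) : psum n.+2 = psum n.+1 + Num.min (e n.+1) (2%:R ^- n.+1).
Proof. by rewrite /psum big_nat_recr. Qed.

Let psum_nondecreasing : {homo psum : n m / (n <= m)%N >-> n <= m}.
Proof.
apply/nondecreasing_seqP => -[|n]; first by rewrite /psum !big_geq.
by rewrite psumS lerDl le_min e_ge0 ltW.
Qed.

(** The first [N] terms are at most [eta] each, and the rest is dominated by a geometric tail. *)
Let psum_le (N n : nat) (eta : R) : 0 <= eta ->
  (forall i, (0 < i <= N)%N -> e i <= eta) -> psum n <= N%:R * eta + 2%:R ^- N.
Proof.
move=> eta0 heta.
have head k : (k <= N)%N -> psum k.+1 <= k%:R * eta.
  elim: k => [_|k IH kN]; first by rewrite /psum big_geq // mul0r.
  rewrite psumS -[k.+1%:R]natr1 mulrDl mul1r; apply: lerD; first exact/IH/ltnW.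
  by rewrite ge_min heta.
have tail k : psum (N + k).+1 <= N%:R * eta + 2%:R ^- N - 2%:R ^- (N + k).
  elim: k => [|k IH]; first by rewrite addn0 addrK head.
  rewrite addnS psumS.
  have : Num.min (e (N + k).+1) (2%:R ^- (N + k).+1) <= 2%:R ^- (N + k).+1.
    by rewrite ge_min lexx orbT.
  by have := half_pow (N + k); lra.
have h : psum n <= psum (N + n).+1.
  by apply: psum_nondecreasing; rewrite ltnW // ltnS leq_addl.
have := tail n; have := half_pow_gt0 (N + n); lra.
Qed.

Let psum_cvg : cvgn psum.
Proof.
apply: nondecreasing_is_cvgn => //; exists 1 => _ [n _ <-].
(* For [N = 0] the condition on [e] is vacuous and the bound is 1. *)
by have := psum_le 0 n 0 (lexx _); rewrite mul0r add0r expr0 invr1; apply => -[].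
Qed.

(** The single term of index [N] already equals [2^-N], and the others are nonnegative. *)
Lemma truncated_series_ge (N : nat) : (0 < N)%N -> 1 <= e N ->
  2%:R ^- N <= limn (fun n : nat => \sum_(1 <= i < n) Num.min (e i) (2%:R ^- i)).
Proof.
case: N => // N _ eN; apply: le_trans (nondecreasing_cvgn_le psum_nondecreasing psum_cvg N.+2).
have p0 : 0 <= psum N.+1.
  have : psum 0 <= psum N.+1 by apply: psum_nondecreasing.
  by rewrite {1}/psum big_geq.
have h1 : 2%:R ^- N.+1 <= 1 :> R by rewrite invf_le1 ?exprn_gt0 ?ltr0n // exprn_ege1 // ler1n.
rewrite psumS -[leLHS]add0r lerD // le_min lexx andbT; exact: le_trans eN.
Qed.

Lemma truncated_series_le (N : nat) (eta : R) : 0 <= eta ->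
  (forall i, (0 < i <= N)%N -> e i <= eta) ->
  limn (fun n : nat => \sum_(1 <= i < n) Num.min (e i) (2%:R ^- i)) <=
    N%:R * eta + 2%:R ^- N.
Proof.
move=> eta0 h; apply: limr_le; first exact: psum_cvg.
by near=> n; apply: psum_le.
Unshelve. all: by end_near. Qed.

Lemma truncated_series_ge0 :
  0 <= limn (fun n : nat => \sum_(1 <= i < n) Num.min (e i) (2%:R ^- i)).
Proof.
have := nondecreasing_cvgn_le psum_nondecreasing psum_cvg 0.
by rewrite {1}/psum big_geq.
Qed.

End TruncatedSeries.

(** * Boundedness and cluster points in compact sets *)

Section Compactness.
Local Open Scope ring_scope.
Local Open Scope classical_set_scope.
Context {R : realType}.

Lemma finite_image_ubound {T : Type} (F : set T) (f : T -> R) :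
  finite_set F -> exists M, forall x, F x -> f x <= M.
Proof.
move=> finF; have /finite_seqP[s hs] := finite_image f finF.
exists (\big[Num.max/0]_(y <- s) y) => x Fx.
have : [set` s] (f x) by rewrite -hs; exists x.
by move=> /= xs; exact: (Order.TotalTheory.le_bigmax_seq 0 (f x) xpredT id).
Qed.

Context {X : Type} {d : X -> X -> R}.
Hypothesis d_metric : is_metric d.
Variable K : set X.
Hypothesis K_compact : metric_compact d K.

Lemma ball_metric_open p (r : R) : metric_open d [set y | d p y < r].
Proof.
move=> x /= px; exists (r - d p x); split; first by rewrite subr_gt0.
by move=> y xy; have := dist_triangle d_metric x p y; lra.
Qed.

Lemma compact_dist_bounded p : exists D : R, forall y, K y -> d p y <= D.
Proof.
have [|J [finJ hJ]] := K_compact _ _ (fun n : nat => ball_metric_open p n%:R).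
  by move=> y _; exists (Num.Def.archi_bound (d p y)) => //; apply: archi_boundP;
    apply: dist_ge0.
have [M hM] := finite_image_ubound J (fun n : nat => n%:R) finJ.
exists M => y /hJ[n Jn /= yn]; apply: le_trans (hM n Jn); exact: ltW.
Qed.

(** Otherwise every point has a ball that the sequence eventually avoids; finitely many of these
    cover [K], so late terms would lie outside [K]. *)
Lemma compact_cluster (k : nat -> X) : (forall n, K (k n)) ->
  exists p, forall e : R, 0 < e -> forall N, exists n, (N <= n)%N /\ d p (k n) < e.
Proof.
move=> Kk; apply: contrapT => nocluster.
have sep p : exists eN : R * nat, 0 < eN.1 /\
    forall n, (eN.2 <= n)%N -> eN.1 <= d p (k n).
  apply: contrapT => h; apply: nocluster; exists p => e e0 N.
  apply: contrapT => h'; apply: h; exists (e, N); split=> //= n Nn.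
  by rewrite leNgt; apply/negP => lt; apply: h'; exists n.
have [eN hN] := choice sep.
have [|J [finJ hJ]] := K_compact _ _ (fun p => ball_metric_open p (eN p).1).
  by move=> y _; exists y => //=; rewrite distxx //; case: (hN y).
have [M hM] := finite_image_ubound J (fun p => (eN p).2%:R) finJ.
have M0 : 0 <= `|M| by apply: normr_ge0.
have /hJ[p Jp /=] := Kk (Num.Def.archi_bound `|M|).
have [_ hp] := hN p.
rewrite ltNge hp // -(ler_nat R) (le_trans (hM p Jp)) //.
exact: le_trans (ler_norm M) (ltW (archi_boundP M0)).
Qed.

End Compactness.

(** * Geometric actions: coarsely dense orbits and completeness *)

Section GeometricAction.
Local Open Scope ring_scope.
Local Open Scope classical_set_scope.
Context {R : realType} {G : groupType} {X : Type} {d : X -> X -> R} {act : G -> X -> X}.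
Hypothesis d_metric : is_metric d.
Hypothesis act_isometric : isometric_action d act.

Lemma act1 x : act 1%g x = x.
Proof. by have [h _] := act_isometric. Qed.

Lemma actM g h x : act (g * h)%g x = act g (act h x).
Proof. by have [_ [m _]] := act_isometric. Qed.

Lemma act_dist g x y : d (act g x) (act g y) = d x y.
Proof. by have [_ [_ m]] := act_isometric. Qed.

Lemma actKV g x : act g (act g^-1%g x) = x.
Proof. by rewrite -actM mulgV act1. Qed.

Hypothesis act_proper : proper_action d act.
Hypothesis act_cocompact : cocompact_action d act.

(** Translates of the bounded set [K] cover the space. The inverse appears because [g] carries rays
    from [g^-1 x0] to rays from [x0]. *)
Lemma orbit_coarsely_dense x0 :
  exists D : R, 0 <= D /\ forall x, exists g, d x (act g^-1%g x0) <= D.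
Proof.
have [K [Kc cov]] := act_cocompact.
have [D hD] := compact_dist_bounded d_metric K Kc x0.
exists `|D|; split; first exact: normr_ge0.
move=> x; have [g [y [Ky ->]]] := cov x; exists g^-1%g.
rewrite invgK act_dist distC //.
exact: le_trans (hD y Ky) (ler_norm _).
Qed.

(* Pulling the tail of a Cauchy sequence back into K, properness leaves only
   finitely many translates of a cluster point as candidate limits. *)
Lemma geometric_action_complete : complete_dist d.
Proof.
move=> x cauchy; have [K [Kc cov]] := act_cocompact.
have /choice[gk hgk] : forall n, exists gk : G * X, K gk.2 /\ x n = act gk.1 gk.2.
  by move=> n; have [g [y h]] := cov (x n); exists (g, y).
have [p hp] := compact_cluster d_metric K Kc (fun n => (gk n).2) (fun n => (hgk n).1).
have [r [r0 finF]] := act_proper p.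
set F := [set g | _] in finF.
have r4 : 0 < r / 4 by lra.
have [N0 hN0] := cauchy _ r4.
have [n0 [N0n0 pn0]] := hp _ r4 N0.
pose l h := act (gk n0).1 (act h p).
apply: contrapT => nolimit.
(* A Cauchy sequence that does not converge to [l h] eventually keeps a positive distance from
   it. *)
have sep h : exists eN : R * nat, 0 < eN.1 /\ forall n, (eN.2 <= n)%N -> eN.1 <= d (x n) (l h).
  apply: contrapT => hh; apply: nolimit; exists (l h) => e e0.
  have e2 : 0 < e / 2 by lra.
  have [N hN] := cauchy _ e2; apply: contrapT => hc.
  apply: hh; exists (e / 2, N); split=> //= n Nn; rewrite leNgt; apply/negP => lt.
  apply: hc; exists N => m Nm.
  have := dist_triangle d_metric (x n) (x m) (l h); have := hN m n Nm Nn; lra.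
have [eN hN] := choice sep.
have [M1 hM1] := finite_image_ubound F (fun h => (eN h).1^-1) finF.
have [M2 hM2] := finite_image_ubound F (fun h => (eN h).2%:R : R) finF.
have M2ge0 : 0 <= `|M2| by apply: normr_ge0.
have M2lt := archi_boundP M2ge0; set N2 := Num.Def.archi_bound `|M2| in M2lt.
(* Smaller than the separation from [l h] for every [h] in the finite set [F]. *)
pose eta := Num.min (`|M1| + 1)^-1 (r / 4).
have eta0 : 0 < eta by rewrite lt_min r4 invr_gt0 andbT ltr_wpDl.
have [n [Nn pn]] := hp _ eta0 (maxn N0 N2).
move: Nn; rewrite geq_max => /andP[N0n N2n].
have pn4 : d p (gk n).2 < r / 4 by apply: lt_le_trans pn _; rewrite ge_min lexx orbT.
(* This element moves [p] by less than [r], so it lies in [F]; yet [x n] is closer than [eta] to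
   [l h]. *)
pose h := ((gk n0).1^-1 * (gk n).1)%g.
have lE : l h = act (gk n).1 p by rewrite /l -actM mulgA mulgV mul1g.
have Fh : F h.
  exists p; split; first by rewrite distxx.
  rewrite -(act_dist (gk n0).1) -/(l h) lE.
  have := dist_triangle d_metric (x n0) (act (gk n0).1 p) (act (gk n).1 p).
  have := dist_triangle d_metric (x n) (x n0) (act (gk n).1 p).
  have -> : d (act (gk n0).1 p) (x n0) = d p (gk n0).2 by rewrite (hgk n0).2 act_dist.
  have -> : d (x n) (act (gk n).1 p) = d p (gk n).2.
    by rewrite {1}(hgk n).2 act_dist distC.
  have := hN0 n0 n N0n0 N0n; lra.
have [e0 he] := hN h.
have : (eN h).1 <= d (x n) (l h).
  apply: he; rewrite -(ler_nat R); apply: le_trans (hM2 h Fh) _.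
  apply: le_trans (ler_norm _) _; apply: le_trans (ltW M2lt) _; by rewrite ler_nat.
rewrite lE {1}(hgk n).2 act_dist distC // leNgt; case/negP.
apply: lt_le_trans pn _; rewrite ge_min; apply/orP; left.
have M1pos : 0 < `|M1| + 1 by rewrite ltr_wpDl.
rewrite -[leRHS]invrK lef_pV2 ?posrE ?invr_gt0 //.
have := hM1 h Fh; have := ler_norm M1; lra.
Qed.

End GeometricAction.

(** * Boundary points, their translates, and rays from nearby points *)

Section Boundary.
Local Open Scope ring_scope.
Local Open Scope classical_set_scope.
Context {R : realType} {X : Type} {d : X -> X -> R}.
Hypothesis d_metric : is_metric d.

Lemma boundary_geodesic_ray A a : boundary d A -> A a -> geodesic_ray d a.
Proof. by move=> [r [_ ->]] []. Qed.

Lemma boundary_asymptotic A a b : boundary d A -> A a -> A b -> asymptotic d a b.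
Proof.
move=> [r [_ ->]] [_ ra] [_ rb].
exact: asymptotic_trans d_metric _ _ _ (asymptotic_sym d_metric _ _ ra) rb.
Qed.

Lemma boundary_neq A B a b : boundary d A -> boundary d B -> A <> B -> A a -> B b ->
  ~ asymptotic d a b.
Proof.
move=> [r [_ ->]] [r' [_ ->]] neq [_ ra] [_ r'b] ab; apply: neq.
have rr' : asymptotic d r r'.
  apply: asymptotic_trans d_metric _ _ _ ra _.
  exact: asymptotic_trans d_metric _ _ _ ab (asymptotic_sym d_metric _ _ r'b).
have r'r := asymptotic_sym d_metric _ _ rr'.
by apply/seteqP; split=> x [gx hx]; split=> //; apply: asymptotic_trans d_metric _ _ _ _ hx.
Qed.

Hypothesis d_cat0 : CAT0 d.
Hypothesis d_complete : complete_dist d.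

Lemma boundary_ray_from A z : boundary d A -> exists a, A a /\ a 0 = z.
Proof.
move=> [r [rr ->]].
by have [a [ga az ra]] := ray_exists d_metric d_cat0 d_complete r z rr; exists a.
Qed.

Context {G : groupType} {act : G -> X -> X}.
Hypothesis act_isometric : isometric_action d act.

(** The chosen ray and the translate of [a] both start at [x0] and are asymptotic, so they agree at
    all nonnegative times. *)
Lemma ray_from_bd_act A a g x0 t : boundary d A -> A a -> a 0 = act g^-1%g x0 -> 0 <= t ->
  ray_from x0 (bd_act d act g A) t = act g (a t).
Proof.
move=> bA Aa az t0.
have iso := act_dist act_isometric.
have gact r : geodesic_ray d r -> geodesic_ray d (act g \o r).
  by move=> rr u v u0 v0 /=; rewrite iso rr.
have ga := gact _ (boundary_geodesic_ray _ _ bA Aa).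
have a0 : (act g \o a) 0 = x0 by rewrite /= az (actKV act_isometric).
have [|[rr [r' [Ar' r'r]]] r0] := epsilon_spec (inhabits (fun _ : R => x0))
    (fun r => bd_act d act g A r /\ r 0 = x0).
  exists (act g \o a); split=> //; split=> //; exists a; split=> //.
  by exists 0 => u u0; rewrite distxx.
rewrite -/(ray_from x0 (bd_act d act g A)) in rr r'r r0 *.
have r'a : asymptotic d (act g \o r') (act g \o a).
  have [C hC] := boundary_asymptotic _ _ _ bA Ar' Aa.
  by exists C => u u0 /=; rewrite iso hC.
have ra := asymptotic_trans d_metric _ _ _ (asymptotic_sym d_metric _ _ r'r) r'a.
have := asymptotic_dist d_metric d_cat0 _ _ t rr ga ra t0.
rewrite r0 a0 (distxx d_metric) => h.
by apply: (dist0_eq d_metric); apply/eqP; rewrite eq_le h dist_ge0.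
Qed.

Lemma bd_dist_bd_act A B a b g x0 : boundary d A -> boundary d B -> A a -> B b ->
  a 0 = act g^-1%g x0 -> b 0 = act g^-1%g x0 ->
  bd_dist d x0 (bd_act d act g A) (bd_act d act g B) =
  limn (fun n : nat => \sum_(1 <= i < n) Num.min (d (a i%:R) (b i%:R)) (2%:R ^- i)).
Proof.
move=> bA bB Aa Bb a0 b0; rewrite /bd_dist; congr (lim (_ @ \oo)).
apply/funext => n; apply: eq_bigr => i _.
rewrite (ray_from_bd_act _ _ _ _ _ bA Aa a0) ?ler0n //.
by rewrite (ray_from_bd_act _ _ _ _ _ bB Bb b0) ?ler0n // act_dist.
Qed.

Lemma bd_dist_bd_act_ge0 A B g x0 : boundary d A -> boundary d B ->
  0 <= bd_dist d x0 (bd_act d act g A) (bd_act d act g B).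
Proof.
move=> bA bB; have [a [Aa a0]] := boundary_ray_from A (act g^-1%g x0) bA.
have [b [Bb b0]] := boundary_ray_from B (act g^-1%g x0) bB.
rewrite (bd_dist_bd_act _ _ _ _ _ _ bA bB Aa Bb a0 b0).
by apply: truncated_series_ge0 => i; apply: dist_ge0.
Qed.

(** The finitely many [g] outside [V] put [g^-1 x0] in a ball about [a 0]; a point of [a] farther
    than its radius plus [D] has only orbit points from [V] nearby. *)
Lemma ray_leaves_finite_subset x0 (D : R) a (V : set G) : cofinite_set V ->
  (forall x, exists g, d x (act g^-1%g x0) <= D) -> geodesic_ray d a ->
  forall s0 : R, exists s g, [/\ s0 <= s, V g & d (a s) (act g^-1%g x0) <= D].
Proof.
move=> finV dense ra s0.
have [M hM] := finite_image_ubound _ (fun g => d (a 0) (act g^-1%g x0)) finV.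
pose s := `|s0| + `|M| + `|D| + 1.
have [g hg] := dense (a s); exists s, g.
have := ler_norm s0; have := ler_norm M; have := ler_norm D => hD hM' hs0.
have := normr_ge0 s0; have := normr_ge0 M; have := normr_ge0 D => pD pM ps0.
split=> //; first by rewrite /s; lra.
apply: contrapT => nV; have := hM g nV.
have := dist_triangle d_metric (act g^-1%g x0) (a 0) (a s).
rewrite (distC d_metric (act g^-1%g x0) (a s)) (ray_dist0 _ _ ra); last by rewrite /s; lra.
rewrite /s in hg *; lra.
Qed.

(** Convexity transfers backtracking from the ray issuing at [c s] to the one issuing at [a 0], at
    the cost of [D]. The threshold [m] precedes [a], since [a] will depend on the group element. *)
Lemma ray_from_near_point_backtracks delta (D : R) A C c :
  0 < delta -> slim_triangles d delta -> boundary d A -> boundary d C -> A <> C -> C c ->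
  exists m, forall a u s, A a -> 0 <= u -> 0 <= s -> m + u <= s -> d (c s) (a 0) <= D ->
    d (a u) (c (s - u)) <= 4 * delta + D.
Proof.
move=> delta0 slim bA bC AC Cc.
have [b [Ab b0]] := boundary_ray_from A (c 0) bA.
have gb := boundary_geodesic_ray _ _ bA Ab; have gc := boundary_geodesic_ray _ _ bC Cc.
have ncb : ~ asymptotic d c b by apply: boundary_neq bC bA _ Cc Ab => /esym.
have [m hm] := ray_to_other_end_backtracks d_metric d_cat0 delta c b delta0 slim gc gb
  (esym b0) ncb.
exists m => a u s Aa u0 s0 mus cz.
have [r [Ar r0]] := boundary_ray_from A (c s) bA.
have ga := boundary_geodesic_ray _ _ bA Aa; have gr := boundary_geodesic_ray _ _ bA Ar.
have := hm u s u0 mus r gr r0 (boundary_asymptotic _ _ _ bA Ab Ar).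
have := asymptotic_dist d_metric d_cat0 a r u ga gr (boundary_asymptotic _ _ _ bA Aa Ar) u0.
rewrite r0 (distC d_metric (a 0)).
have := dist_triangle d_metric (r u) (a u) (c (s - u)); lra.
Qed.

(** The tail of [c] after time [s] is a ray asymptotic to [a], so convexity applies to the pair. *)
Lemma ray_from_near_point_advances (D : R) A a c u s : boundary d A -> A a -> A c ->
  0 <= u -> 0 <= s -> d (c s) (a 0) <= D -> d (a u) (c (s + u)) <= D.
Proof.
move=> bA Aa Ac u0 s0 cz.
have ga := boundary_geodesic_ray _ _ bA Aa; have gc := boundary_geodesic_ray _ _ bA Ac.
have gshift : geodesic_ray d (fun t => c (s + t)).
  move=> t t' t0 t'0; rewrite gc ?addr_ge0 //; congr (`|_|); ring.
have ashift : asymptotic d a (fun t => c (s + t)).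
  have [C hC] := boundary_asymptotic _ _ _ bA Aa Ac; exists (C + s) => t t0.
  have := dist_triangle d_metric (c t) (a t) (c (s + t)); have := hC t t0.
  rewrite ray_dist //; lra.
have := asymptotic_dist d_metric d_cat0 a _ u ga gshift ashift u0.
rewrite /= addr0 (distC d_metric (a 0)); lra.
Qed.

(** * Orbit estimates for the boundary distance under hyperbolicity *)

Variables (x0 : X) (D delta : R).
Hypothesis D_ge0 : 0 <= D.
Hypothesis orbit_dense : forall x, exists g, d x (act g^-1%g x0) <= D.
Hypothesis delta_gt0 : 0 < delta.
Hypothesis d_slim : slim_triangles d delta.

Lemma bd_dist_frequently_large : exists N : nat, forall A B,
  boundary d A -> boundary d B -> A <> B -> forall V : set G, cofinite_set V ->
  exists g, V g /\ 2%:R ^- N <= bd_dist d x0 (bd_act d act g A) (bd_act d act g B).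
Proof.
have D0 := D_ge0; have dl0 := delta_gt0.
(* At time [N] the rays to [A] and [B] are near [a (s + N)] and [a (s - N)], hence at least
   [2 * N - 4 * delta - 2 * D] apart, which exceeds 1. [N] is fixed before [A] and [B], making the
   bound uniform. *)
pose B0 := 4 * delta + 2 * D + 1.
have B0ge0 : 0 <= B0 by rewrite /B0; lra.
have := archi_boundP B0ge0; set N := Num.Def.archi_bound B0 => hN.
have Npos : 0 < N%:R :> R by rewrite /B0 in hN; lra.
exists N => A B bA bB AB V finV.
have [a [Aa _]] := boundary_ray_from A x0 bA.
have ra := boundary_geodesic_ray _ _ bA Aa.
have BA : B <> A by move/esym.
have [m hm] := ray_from_near_point_backtracks _ D _ _ _ delta_gt0 d_slim bB bA BA Aa.
have [s [g [hs Vg near]]] := ray_leaves_finite_subset x0 D a V finV orbit_dense ra (`|m| + N%:R).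
exists g; split=> //.
have m0 := normr_ge0 m; have m1 := ler_norm m.
have s0 : 0 <= s by lra.
have [a' [Aa' a'0]] := boundary_ray_from A (act g^-1%g x0) bA.
have [b [Bb b0]] := boundary_ray_from B (act g^-1%g x0) bB.
rewrite (bd_dist_bd_act _ _ _ _ _ _ bA bB Aa' Bb a'0 b0).
apply: truncated_series_ge; first by move=> i; apply: dist_ge0.
  by rewrite -(ltr_nat R).
have mN : m + N%:R <= s by lra.
have hb := hm b N%:R s Bb (ltW Npos) s0 mN; rewrite b0 in hb; have {}hb := hb near.
have ha := ray_from_near_point_advances D A a' a N%:R s bA Aa' Aa (ltW Npos) s0.
rewrite a'0 in ha; have {}ha := ha near.
have := dist_triangle d_metric (b N%:R) (a (s - N%:R)) (a (s + N%:R)).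
have := dist_triangle d_metric (a' N%:R) (b N%:R) (a (s + N%:R)).
rewrite (ray_dist _ _ _ ra); last lra.
rewrite (distC d_metric (b N%:R) (a' N%:R)) (distC d_metric (a (s - N%:R))).
rewrite /B0 in hN; lra.
Qed.

(* Seen from a point far out on a ray to a third boundary point C, the rays to A and to B
   both start by running back along that ray, so they stay close for a long time. *)
Lemma bd_dist_frequently_small A B C : boundary d A -> boundary d B -> boundary d C ->
  A <> C -> B <> C -> forall e : R, 0 < e -> forall V : set G, cofinite_set V ->
  exists g, V g /\ bd_dist d x0 (bd_act d act g A) (bd_act d act g B) <= e.
Proof.
move=> bA bB bC AC BC e e0 V finV.
have D0 := D_ge0; have dl0 := delta_gt0.
have [N hN] : exists N : nat, 2%:R ^- N <= e / 2.
  have h : 0 <= 2 / e by rewrite divr_ge0 // ltW.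
  exists (Num.Def.archi_bound (2 / e)).
  rewrite -[leRHS]invrK lef_pV2 ?posrE ?exprn_gt0 ?ltr0n // ?invr_gt0 ?divr_gt0 //.
  rewrite invf_div; apply: le_trans (ltW (archi_boundP h)) _.
  by rewrite -natrX ler_nat ltnW // ltn_expl.
(* [k] bounds the distance of the two rays at time [M]; [eta] makes the first [N] terms total at
   most [e / 2]. *)
pose k := 2 * (4 * delta + D); pose eta := e / (2 * (N%:R + 1)).
have N0 : 0 <= N%:R :> R by apply: ler0n.
have k0 : 0 <= k by rewrite /k; lra.
have eta0 : 0 < eta by rewrite /eta divr_gt0 //; lra.
(* With [M] above [q], contraction from time [M] to a time at most [N] brings [k] below [eta]. *)
pose q := N%:R * k / eta; pose M := N%:R + q + 1.
have q0 : 0 <= q by apply: divr_ge0; [apply: mulr_ge0 | apply: ltW].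
have Mpos : 0 < M by rewrite /M; lra.
have [c [Cc _]] := boundary_ray_from C x0 bC.
have rc := boundary_geodesic_ray _ _ bC Cc.
have [m hm] := ray_from_near_point_backtracks _ D _ _ _ delta_gt0 d_slim bA bC AC Cc.
have [m' hm'] := ray_from_near_point_backtracks _ D _ _ _ delta_gt0 d_slim bB bC BC Cc.
have [s [g [hs Vg near]]] :=
  ray_leaves_finite_subset x0 D c V finV orbit_dense rc (`|m| + `|m'| + M).
exists g; split=> //.
have m0 := normr_ge0 m; have m1 := ler_norm m.
have m'0 := normr_ge0 m'; have m'1 := ler_norm m'.
have s0 : 0 <= s by lra.
have [a [Aa a0]] := boundary_ray_from A (act g^-1%g x0) bA.
have [b [Bb b0]] := boundary_ray_from B (act g^-1%g x0) bB.
rewrite (bd_dist_bd_act _ _ _ _ _ _ bA bB Aa Bb a0 b0).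
have mM : m + M <= s by lra.
have mM' : m' + M <= s by lra.
have ha := hm a M s Aa (ltW Mpos) s0 mM; rewrite a0 in ha; have {}ha := ha near.
have hb := hm' b M s Bb (ltW Mpos) s0 mM'; rewrite b0 in hb; have {}hb := hb near.
have ab : d (a M) (b M) <= k.
  have := dist_triangle d_metric (c (s - M)) (a M) (b M).
  rewrite (distC d_metric (c (s - M)) (b M)) /k; lra.
apply: le_trans (truncated_series_le _ _ N eta (ltW eta0) _) _.
- by move=> i; apply: dist_ge0.
- move=> i /andP[_ iN].
  have iM : 0 <= (i%:R : R) <= M.
    apply/andP; split; first exact: ler0n.
    by move: iN; rewrite -(ler_nat R) /M; lra.
  apply: le_trans (rays_common_origin d_metric d_cat0 a b i%:R M _ _ _ iM Mpos) _.
  + exact: boundary_geodesic_ray bA Aa.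
  + exact: boundary_geodesic_ray bB Bb.
  + by rewrite a0 b0.
  apply: (@le_trans _ _ (N%:R / M * k)).
    apply: ler_pM => //; [by rewrite divr_ge0 // ltW | exact: dist_ge0 |].
    by rewrite ler_pM2r ?invr_gt0 // ler_nat.
  rewrite mulrAC ler_pdivrMr // (mulrC eta) -ler_pdivrMr // -/q /M; lra.
- have -> : e = e / 2 + e / 2 by field.
  apply: lerD => //.
  rewrite /eta mulrA ler_pdivrMr; last lra.
  have -> : e / 2 * (2 * (N%:R + 1)) = N%:R * e + e by field.
  by rewrite lerDl ltW.
Qed.

End Boundary.

(** * From orbit estimates to limsup and liminf over cofinite sets *)

Theorem theorem4p2 (R : realType) (G : groupType) (X : Type) (d : X -> X -> R)
  (act : G -> X -> X) (x0 : X) :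
  is_metric d -> CAT0 d -> geometric_action d act ->
  (exists A B C, boundary d A /\ boundary d B /\ boundary d C /\
     A <> B /\ B <> C /\ A <> C) ->
  hyperbolic d ->
  scrambled d act x0 /\
  exists c : R, (0 < c)%R /\
    forall A B, boundary d A -> boundary d B -> A <> B ->
      (c%:E < limsup_cof (fun g : G => bd_dist d x0 (bd_act d act g A) (bd_act d act g B)))%E.
Proof.
move=> d_metric d_cat0 [iso [proper cocompact]] three [delta [delta0 hyp]].
have slim : slim_triangles d delta.
  by move=> p q r c1 c2 c3 g1 g2 g3; have [] := hyp p q r c1 c2 c3 g1 g2 g3.
have complete := geometric_action_complete d_metric iso proper cocompact.
have [D [D0 dense]] := orbit_coarsely_dense d_metric iso cocompact x0.
have [N large] := bd_dist_frequently_large d_metric d_cat0 complete iso x0 D delta D0 dense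
  delta0 slim.
have pow0 : (0 < 2%:R ^- N :> R)%R by rewrite invr_gt0 exprn_gt0 // ltr0n.
have limsup_ge A B : boundary d A -> boundary d B -> A <> B ->
    ((2%:R ^- N)%:E <=
      limsup_cof (fun g : G => bd_dist d x0 (bd_act d act g A) (bd_act d act g B)))%E.
  move=> bA bB AB; apply/ereal_infP => _ [V finV <-].
  have [g [Vg hg]] := large A B bA bB AB V finV.
  by apply: le_ereal_sup_tmp; exists (bd_dist d x0 (bd_act d act g A) (bd_act d act g B))%:E;
    [exists g | rewrite lee_fin].
split; last first.
  (* Halving turns the weak lower bound into a strict one. *)
  exists (2%:R ^- N / 2)%R; split; first by rewrite divr_gt0.
  move=> A B bA bB AB; apply: lt_le_trans (limsup_ge A B bA bB AB).
  by rewrite lte_fin; lra.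
move=> A B bA bB AB; split.
  by apply: lt_le_trans (limsup_ge A B bA bB AB); rewrite lte_fin.
(* Pigeonhole: of three distinct boundary points, one differs from both [A] and [B]. *)
have [C [bC [AC BC]]] : exists C, boundary d C /\ A <> C /\ B <> C.
  move: three => [A1 [A2 [A3 [b1 [b2 [b3 [n12 [n23 n13]]]]]]]].
  apply: contrapT => none.
  have avoid C : boundary d C -> A = C \/ B = C.
    move=> bC; have [->|AC] := pselect (A = C); first by left.
    by right; apply: contrapT => BC; apply: none; exists C.
  by case: (avoid _ b1) (avoid _ b2) (avoid _ b3) => [?|?] [?|?] [?|?]; congruence.
apply/eqP; rewrite eq_le; apply/andP; split.
  apply/ereal_supP => _ [V finV <-]; apply/lee_addgt0Pr => e e0; rewrite add0e.
  have [g [Vg hg]] := bd_dist_frequently_small d_metric d_cat0 complete iso x0 D delta D0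
    dense delta0 slim A B C bA bB bC AC BC e e0 V finV.
  by apply: ge_ereal_inf; exists (bd_dist d x0 (bd_act d act g A) (bd_act d act g B))%:E;
    [exists g | rewrite lee_fin].
apply: le_ereal_sup_tmp.
(* For the lower bound the whole group serves as cofinite set, all distances being nonnegative. *)
exists (ereal_inf
  [set (bd_dist d x0 (bd_act d act g A) (bd_act d act g B))%:E | g in setT]%classic).
  by exists setT => //=; rewrite setCT; exact: finite_set0.
apply/ereal_infP => _ [g _ <-]; rewrite lee_fin.
exact: bd_dist_bd_act_ge0.
Qed.
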